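(* Let $F=F(X)$ be a free group of finite rank, let $L\subseteq F$ be a prefix-closed regular set and let $R\subseteq L$ be a regular subset. Then either the prefix closure $\overline{R}$ of $R$ contains a non-small $L$-cone, or $\overline{R}$ is exponentially $\lambda_L$-measurable.
   Context: $F=F(X)$ is the free group with finite basis $X$; elements of $F$ are identified with reduced words in $X\cup X^{-1}$, and $|w|$ is the length of the reduced word $w$. $S_k=\{w\in F:|w|=k\}$. A subset of $F$ is regular if, as a set of reduced words over $X\cup X^{-1}$, it is accepted by a finite deterministic automaton. The prefix closure $\overline{R}$ of $R$ is the set of all initial segments of words in $R$; a set $L$ is prefix-closed if $\overline{L}=L$ (so $R\subseteq L$ implies $\overline{R}\subseteq L$). The measure $\lambda_L$: let $\mathcal{A}$ be a finite deterministic automaton accepting $L$, with exactly one initial state, with all states accessible from the initial state, and with every state leading to an accepting state (hence, as $L$ is prefix-closed, all states of $\mathcal A$ are accepting). For a word $w\in L$, consider the unique path in $\mathcal{A}$ from the initial state labelled by $w$; a walker at a state $P$ of $\mathcal{A}$ moves along each of the $\nu(P)$ edges exiting from $P$ with probability $1/\nu(P)$. Then $\lambda_L(w)$ is the probability that the walker, started at the initial state, follows this path in its first $|w|$ steps. Explicitly, if $w=y_1y_2\cdots y_k$ is a reduced word with $y_i\in X\cup X^{-1}$ and $w_i=y_1\cdots y_i$, then $$\lambda_L(w)=\prod_{i=0}^{k-1}\frac{1}{\nu(w_i)},\qquad \nu(u)=\#\{y\in X\cup X^{-1} : uy \text{ is a reduced word and } uy\in L\},$$ with $\lambda_L(1)=1$.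 For $Q\subseteq L$ put $f'_k(Q,L)=\sum_{w\in Q\cap S_k}\lambda_L(w)$. The set $Q$ is exponentially $\lambda_L$-measurable if there is $q$ with $0<q<1$ such that $f'_k(Q,L)\le q^k$ for all sufficiently large $k$. For $w\in F$, the cone $C(w)$ is the set of all reduced words having $w$ as an initial segment, and $C_L(w)=L\cap C(w)$ is called an $L$-cone. The $L$-cone $C_L(w)$ is called small (or $L$-small) if it is exponentially $\lambda_L$-measurable, and non-small otherwise. *)

(* Defs.v *)
From HB Require Import structures.
From mathcomp Require Import all_boot all_order all_algebra.
From mathcomp Require Import all_classical reals.

Set Implicit Arguments.
Unset Strict Implicit.
Unset Printing Implicit Defensive.

Import Order.TTheory GRing.Theory Num.Theory.

Local Open Scope classical_set_scope.
Local Open Scope ring_scope.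

(* [(x, false)] stands for the generator x and [(x, true)] for its inverse. *)
Notation letter X := (X * bool)%type.
Notation word X := (seq (letter X)).

Definition inv_letter (X : finType) (a : letter X) : letter X := (a.1, ~~ a.2).

Definition reduced (X : finType) (w : word X) : bool :=
  sorted (fun a b => b != inv_letter a) w.

(* The free group with basis X, its elements being the reduced words; the unit
   is [[::]] and the length of an element is [size]. *)
Definition free_group (X : finType) : set (word X) := [set w | reduced w].
Arguments free_group X : clear implicits.

Definition sphere (X : finType) (k : nat) : set (word X) :=
  [set w | free_group X w /\ size w = k].
Arguments sphere X k : clear implicits.

(* The transition function is partial: a state has at most one, and possibly
   no, outgoing edge with a given label. *)
Record dfa (A : finType) := Dfa {
  dfa_state : finType;
  dfa_init : dfa_state;
  dfa_final : {set dfa_state};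
  dfa_step : dfa_state -> A -> option dfa_state }.

Definition dfa_run (A : finType) (M : dfa A) (w : seq A) :
    option (dfa_state M) :=
  foldl (fun s a => obind (fun p => dfa_step p a) s) (Some (dfa_init M)) w.

Definition dfa_accepts (A : finType) (M : dfa A) (w : seq A) : bool :=
  if dfa_run M w is Some s then s \in dfa_final M else false.

Definition regular_set (X : finType) (L : set (word X)) : Prop :=
  exists M : dfa (letter X), L = [set w | dfa_accepts M w].

Definition prefix_closure (X : finType) (L : set (word X)) : set (word X) :=
  [set u | exists2 w, L w & prefix u w].

Definition prefix_closed (X : finType) (L : set (word X)) : Prop :=
  prefix_closure L = L.

(* In a trimmed automaton for a prefix-closed L, the edges leaving the state
   reached by u are labelled by the letters y such that uy is a word of L. *)
Definition nu (X : finType) (L : set (word X)) (u : word X) : nat :=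
  #|[pred y : letter X | reduced (rcons u y) & `[< L (rcons u y) >]]|.

(* Only meaningful for w in L, where every factor is nonzero if L is a
   prefix-closed set of reduced words. *)
Definition lambda (R : realType) (X : finType) (L : set (word X))
    (w : word X) : R :=
  \prod_(i < size w) (nu L (take i w))%:R^-1.

(* The index set is finite, X being finite, so that this is a genuine sum. *)
Definition freq (R : realType) (X : finType) (k : nat)
    (Q L : set (word X)) : R :=
  \sum_(w \in Q `&` sphere X k) lambda R L w.

Definition exp_measurable (R : realType) (X : finType)
    (L Q : set (word X)) : Prop :=
  exists2 q : R, 0 < q < 1 &
    exists N : nat, forall k : nat, (N <= k)%N -> freq R k Q L <= q ^+ k.

Definition cone (X : finType) (w : word X) : set (word X) :=
  [set v | free_group X v /\ prefix w v].

Definition Lcone (X : finType) (L : set (word X)) (w : word X) :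
    set (word X) :=
  L `&` cone w.

Definition small_Lcone (R : realType) (X : finType) (L : set (word X))
    (w : word X) : Prop :=
  exp_measurable R L (Lcone L w).

(* Main.v *)
Require Import Defs.
From HB Require Import structures.
From mathcomp Require Import all_boot all_order all_algebra.
From mathcomp Require Import all_classical reals.

Set Implicit Arguments.
Unset Strict Implicit.
Unset Printing Implicit Defensive.

Import Order.TTheory GRing.Theory Num.Theory.

Local Open Scope classical_set_scope.
Local Open Scope ring_scope.

(** Let [P] be the prefix closure of [K]; it lies in [L] because [L] is
    prefix-closed. Run the random walk on [L]: from a word [w] it moves to each
    of the [nu L w] words [rcons w y] of [L] with equal probability, and it dies
    where [nu L w = 0]. The frequency of a set at level [k] is the probability
    that the walk started at the empty word is in this set after [k] steps
    ([freq_visit]), so everything is a statement about this walk.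

    Say that [w] in [P] can escape if some word of [L] extending [w] either
    leaves [P] or is a dead end. If some [w] in [P] cannot escape, then its
    whole [L]-cone lies in [P] and has no dead end; the walk, once at [w], stays
    in the cone forever, so the frequencies of the cone are bounded below by a
    positive constant and the cone is not small ([live_cone_nonsmall]). This is
    the first alternative.

    Otherwise every [w] in [P] can escape. Whether a given [u] is an escape for
    [w] depends only on the states that [w] reaches in automata for [L] and [K];
    as there are finitely many pairs of states, there is a bound [m] on the
    length of an escape that is valid for all [w] ([escape_bounded]). The walk
    follows a prescribed path of length at most [m] with probability at least
    [d ^+ m], where [d^-1] bounds the number of letters, so in any [m.+1]
    consecutive steps it leaves [P] for good, or dies, with at least this
    probability ([visit_escape]). Hence the frequencies of [P] decay
    geometrically ([visit_decay]). *)

(** * Powers and geometric decay *)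

Lemma bernoulli_ineq (F : realFieldType) (x : F) (n : nat) :
  0 <= 1 + x -> 1 + x *+ n <= (1 + x) ^+ n.
Proof.
move=> x1; elim: n => [|n IH]; first by rewrite mulr0n addr0 expr0.
rewrite exprS; apply: le_trans (ler_wpM2l x1 IH).
rewrite mulrDl mul1r mulrDr mulr1 mulrS [x + _ *+ n]addrC addrA lerD2l.
by rewrite lerDl mulrnAr mulrn_wge0 // -expr2 sqr_ge0.
Qed.

Lemma expr_lt_eventually (R : realType) (q c : R) :
  0 < q < 1 -> 0 < c -> exists N, forall k, (N <= k)%N -> q ^+ k < c.
Proof.
move=> /andP[q0 q1] c0.
set h := q^-1 - 1.
have h0 : 0 < h by rewrite subr_gt0 invf_gt1.
have qE : q^-1 = 1 + h by rewrite /h addrC subrK.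
exists (Num.bound (c^-1 / h)) => k Nk.
rewrite -ltf_pV2 ?posrE ?exprn_gt0 // -exprVn qE.
have hb : c^-1 / h < (Num.bound (c^-1 / h))%:R.
  by apply: archi_boundP; rewrite divr_ge0 // ?invr_ge0 ltW.
apply: lt_le_trans (bernoulli_ineq k _); last by rewrite -qE invr_ge0 ltW.
apply: (@lt_trans _ _ (h *+ k)); last by rewrite ltrDr.
rewrite -mulr_natr mulrC -ltr_pdivrMr //.
by apply: lt_le_trans hb _; rewrite ler_nat.
Qed.

(** Decay by the factor [1 - e] per block of [m] steps is exponential decay per
    step: by Bernoulli's inequality [q = 1 - e / (2 * m)] satisfies
    [1 - e <= q ^+ (2 * m)], the factor 2 absorbing the incomplete last
    block. *)
Lemma geometric_exp_bound (F : realFieldType) (f : nat -> F) (e : F) (m : nat) :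
  0 < e <= 1 -> (0 < m)%N ->
  (forall i, f i <= (1 - e) ^+ (i %/ m)) ->
  exists2 q : F, 0 < q < 1 &
    exists N : nat, forall k, (N <= k)%N -> f k <= q ^+ k.
Proof.
move=> /andP[e0 e1] m0 fle.
have m20 : (0 : F) < (m.*2)%:R by rewrite ltr0n double_gt0.
set x := e / (m.*2)%:R.
have x0 : 0 < x by rewrite divr_gt0.
have x1 : x < 1.
  rewrite ltr_pdivrMr // mul1r (le_lt_trans e1) // (ltr_nat F 1).
  by rewrite -addnn (leq_add m0 m0).
have q0 : 0 < 1 - x by rewrite subr_gt0.
exists (1 - x); first by rewrite q0 gtrBl.
exists m => k mk; apply: le_trans (fle k) _.
have step : 1 - e <= (1 - x) ^+ m.*2.
  have := @bernoulli_ineq F (- x) m.*2 (ltW q0).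
  by rewrite mulNrn -[x *+ _]mulr_natr /x divfK // gt_eqF.
(* k < m (k/m + 1) <= 2 m (k/m), the latter because k/m is at least 1 *)
have kle : (k <= m.*2 * (k %/ m))%N.
  rewrite {1}(divn_eq k m) -addnn mulnDl [(m * _)%N]mulnC leq_add2l.
  by rewrite (leq_trans (ltnW (ltn_pmod k m0))) // leq_pmull // divn_gt0.
apply: (@le_trans _ _ ((1 - x) ^+ (m.*2 * (k %/ m)))).
  by rewrite exprM lerXn2r // nnegrE ?exprn_ge0 ?subr_ge0 // ltW.
by apply: ler_wiXn2l kle; rewrite ?gerBl ltW.
Qed.

(** * Prefix-closed sets and the transition weights *)

Lemma mem_prefix_closed (X : finType) (L : set (word X)) (w u : word X) :
  prefix_closed L -> L (w ++ u) -> L w.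
Proof.
by move=> Lc Lwu; rewrite -Lc; exists (w ++ u) => //; exact: prefix_prefix.
Qed.

Lemma prefix_closure_idem (X : finType) (K : set (word X)) :
  prefix_closed (prefix_closure K).
Proof.
apply/seteqP; split=> [u [v [w Kw vw] uv]|u Pu].
  by exists w => //; exact: prefix_trans uv vw.
by exists u => //; exact: prefix_refl.
Qed.

Lemma prefix_closureP (X : finType) (K : set (word X)) (w : word X) :
  prefix_closure K w <-> exists u, K (w ++ u).
Proof.
split=> [[v Kv /prefixP[u vE]]|[u Kwu]]; first by exists u; rewrite -vE.
by exists (w ++ u) => //; exact: prefix_prefix.
Qed.

Lemma nu_sum (R : realType) (X : finType) (L : set (word X)) (w : word X) :
  L `<=` free_group X ->
  (nu L w)%:R = \sum_(y : letter X | `[< L (rcons w y) >]) (1 : R).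
Proof.
move=> LF; rewrite sumr_const; congr (_%:R); apply: eq_card => y.
by rewrite !inE unfold_in; apply: andb_idl => /asboolP /LF.
Qed.

Lemma nu_gt0 (X : finType) (L : set (word X)) (w : word X) (y : letter X) :
  L `<=` free_group X -> L (rcons w y) -> (0 < nu L w)%N.
Proof.
move=> LF Lwy; apply/card_gt0P; exists y; rewrite !inE.
by apply/andP; split; [exact: LF | exact/asboolP].
Qed.

Lemma lambda_rcons (R : realType) (X : finType) (L : set (word X))
    (w : word X) (y : letter X) :
  lambda R L (rcons w y) = lambda R L w * (nu L w)%:R^-1.
Proof.
rewrite /lambda size_rcons big_ord_recr /= -cats1 take_size_cat //.
by congr (_ * _); apply: eq_bigr => i _; rewrite takel_cat // ltnW.
Qed.

(** * The random walk *)

(** The probability that the walk on [L] started at [w] is in [Q] after [k]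
    steps, by conditioning on the first step; it is defined for every [w], so
    that frequencies can be compared along the walk. *)
Fixpoint visit (R : realType) (X : finType) (L Q : set (word X)) (k : nat)
    (w : word X) : R :=
  if k is k'.+1 then
    \sum_(y : letter X | `[< L (rcons w y) >])
      (nu L w)%:R^-1 * visit R L Q k' (rcons w y)
  else (`[< Q w >])%:R.

Fixpoint words (A : finType) (k : nat) : seq (seq A) :=
  if k is k'.+1 then [seq y :: u | y <- enum A, u <- words A k'] else [:: [::]].

Lemma mem_words (A : finType) (k : nat) (w : seq A) :
  (w \in words A k) = (size w == k).
Proof.
elim: k w => [|k IH] [|y w] //=.
  by apply/allpairsP => -[[z u] []].
rewrite eqSS -IH; apply/allpairsP/idP => [[[z u] [_ uk []]]|wk] /=.
  by move=> _ ->.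
by exists (y, w); rewrite mem_enum.
Qed.

Lemma words_uniq (A : finType) (k : nat) : uniq (words A k).
Proof.
elim: k => //= k IH; apply: allpairs_uniq => //; first exact: enum_uniq.
by move=> [y u] [z v] _ _ [-> ->].
Qed.

(** The link with [lambda]: the weight of a word of [L] extending [w] is the
    weight of [w] times the probability of the remaining steps. Words leaving
    [L] contribute to neither side, because [L] is prefix-closed. *)
Lemma lambda_visit (R : realType) (X : finType) (L Q : set (word X)) (k : nat)
    (w : word X) :
  prefix_closed L -> Q `<=` L ->
  \sum_(u <- words (letter X) k | `[< Q (w ++ u) >]) lambda R L (w ++ u)
  = lambda R L w * visit R L Q k w.
Proof.
move=> Lc QL; elim: k w => [|k IH] w /=.
  by rewrite big_mkcond big_seq1 cats0; case: asboolP; rewrite ?mulr1 ?mulr0.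
rewrite big_mkcond big_allpairs_dep big_enum mulr_sumr [RHS]big_mkcond /=.
apply: eq_bigr => y _; rewrite -big_mkcond.
under eq_bigl do rewrite -cat_rcons; under eq_bigr do rewrite -cat_rcons.
case: asboolP => [_|NL]; first by rewrite IH lambda_rcons mulrA.
by apply: big1 => u /asboolP /QL /(mem_prefix_closed Lc) /NL.
Qed.

Lemma freq_visit (R : realType) (X : finType) (L Q : set (word X)) (k : nat) :
  L `<=` free_group X -> prefix_closed L -> Q `<=` L ->
  freq R k Q L = visit R L Q k [::].
Proof.
move=> LF Lc QL.
have -> : visit R L Q k [::] = lambda R L [::] * visit R L Q k [::].
  by rewrite /lambda big_ord0 mul1r.
rewrite -lambda_visit // -big_filter fsbig_seq ?filter_uniq ?words_uniq //.
apply: eq_fsbigl; apply/seteqP; split=> w /=.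
  move=> [Qw [_ wk]]; rewrite mem_filter mem_words wk eqxx andbT.
  exact/asboolP.
rewrite mem_filter mem_words => /andP[/asboolP Qw /eqP wk].
by split=> //; split=> //; apply/LF/QL.
Qed.

Lemma visit_ge0 (R : realType) (X : finType) (L Q : set (word X)) (k : nat)
    (w : word X) : 0 <= visit R L Q k w.
Proof.
elim: k w => [|k IH] w /=; first exact: ler0n.
by apply: sumr_ge0 => y _; rewrite mulr_ge0 ?invr_ge0.
Qed.

(** One step of the walk preserves total mass, except at a dead end. *)
Lemma step_weight_sum (R : realType) (X : finType) (L : set (word X))
    (w : word X) (c : R) :
  L `<=` free_group X ->
  \sum_(y : letter X | `[< L (rcons w y) >]) (nu L w)%:R^-1 * c
  = if (0 < nu L w)%N then c else 0.
Proof.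
move=> LF; rewrite -mulr_sumr -[X in \sum_(_ | _) X]mul1r -mulr_suml -nu_sum //.
by case: posnP => [->|n0]; rewrite ?mul0r ?mulr0 // mulKf // pnatr_eq0 -lt0n.
Qed.

(** The walk only extends words, so it never returns to a prefix-closed set. *)
Lemma visit_out (R : realType) (X : finType) (L P : set (word X)) (k : nat)
    (w : word X) : prefix_closed P -> ~ P w -> visit R L P k w = 0.
Proof.
move=> Pc; elim: k w => [|k IH] w NP /=; first by case: asboolP.
apply: big1 => y _; rewrite IH ?mulr0 //.
by rewrite -cats1 => /(mem_prefix_closed Pc).
Qed.

Lemma visit_le1 (R : realType) (X : finType) (L Q : set (word X)) (k : nat)
    (w : word X) : L `<=` free_group X -> visit R L Q k w <= 1.
Proof.
move=> LF; elim: k w => [|k IH] w /=.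
  by case: asboolP => _ //=; exact: ler01.
apply: (@le_trans _ _
  (\sum_(y : letter X | `[< L (rcons w y) >]) (nu L w)%:R^-1 * 1)).
  by apply: ler_sum => y _; rewrite ler_wpM2l ?invr_ge0.
by rewrite step_weight_sum //; case: ifP => // _; exact: ler01.
Qed.

(** The Markov property: the walk is in [P] after [i + j] steps only if it is in
    [P] after [i] steps. *)
Lemma visit_add_le (R : realType) (X : finType) (L P : set (word X)) (c : R)
    (i j : nat) (w : word X) :
  prefix_closed P -> (forall v, P v -> visit R L P j v <= c) ->
  visit R L P (i + j) w <= c * visit R L P i w.
Proof.
move=> Pc cP; elim: i w => [|i IH] w /=.
  case: asboolP => Pw; first by rewrite mulr1 cP.
  by rewrite mulr0 visit_out.
rewrite mulr_sumr; apply: ler_sum => y _.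
by rewrite mulrCA ler_wpM2l ?invr_ge0.
Qed.

Lemma visit_decay (R : realType) (X : finType) (L P : set (word X)) (c : R)
    (m k : nat) (w : word X) :
  L `<=` free_group X -> prefix_closed P ->
  0 <= c -> (forall v, P v -> visit R L P m v <= c) ->
  visit R L P k w <= c ^+ (k %/ m).
Proof.
move=> LF Pc c0 cP; rewrite {1}(divn_eq k m).
elim: (k %/ m)%N => [|i IH]; first by rewrite expr0 visit_le1.
rewrite mulSnr addnAC exprS; apply: le_trans (visit_add_le _ _ Pc cP) _.
by rewrite ler_wpM2l.
Qed.

(** * Escaping from a prefix-closed set *)

Definition escapes (X : finType) (L P : set (word X)) (w u : word X) : Prop :=
  L (w ++ u) /\ (~ P (w ++ u) \/ nu L (w ++ u) = 0%N).

Lemma nu_le (X : finType) (L : set (word X)) (w : word X) :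
  (nu L w <= #|{: letter X}|)%N.
Proof. exact: max_card. Qed.

(** Following [u] step by step costs at most a factor [#|letter X|^-1] per
    letter. The successor keeps the bound positive when [X] is empty. *)
Lemma visit_escape (R : realType) (X : finType) (L P : set (word X))
    (w u : word X) (j : nat) :
  L `<=` free_group X -> prefix_closed L -> prefix_closed P ->
  escapes L P w u -> (size u < j)%N ->
  visit R L P j w <= 1 - (#|{: letter X}|.+1)%:R^-1 ^+ size u.
Proof.
move=> LF Lc Pc; elim: u w j => [|y u IH] w [//|j]; rewrite /escapes ?cats0.
  move=> [_ [NP|n0]] _; rewrite expr0 subrr; first by rewrite visit_out.
  by rewrite /= n0 big1 // => y _; rewrite invr0 mul0r.
rewrite -cat_rcons => esc /= uj; set d : R := _.+1%:R.
set e := d^-1 ^+ size u.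
have Lwy : L (rcons w y) by case: esc => /(mem_prefix_closed Lc).
have n0 : (0 : R) < (nu L w)%:R by rewrite ltr0n (nu_gt0 LF Lwy).
(* isolate the step along the path; bound every other branch by 1 *)
rewrite (bigD1 y) /=; last exact/asboolP.
apply: (@le_trans _ _ ((nu L w)%:R^-1 * (1 - e) +
  \sum_(z : letter X | `[< L (rcons w z) >] && (z != y)) (nu L w)%:R^-1 * 1)).
  apply: lerD.
    by apply: ler_wpM2l (IH _ _ esc uj); rewrite invr_ge0 ltW.
  by apply: ler_sum => z _; rewrite ler_wpM2l ?invr_ge0 ?visit_le1 // ltW.
have := step_weight_sum w (1 : R) LF; rewrite (nu_gt0 LF Lwy) (bigD1 y) /=;
  last exact/asboolP.
set S := \sum_(_ | _ && _) _ => tot.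
rewrite mulrBr addrAC tot lerD2l lerN2 exprS ler_wpM2r //.
  by rewrite exprn_ge0 // invr_ge0.
by rewrite lef_pV2 ?posrE ?n0 ?ltr0n // ler_nat leqW // nu_le.
Qed.

(** A fixed word of [L] is reached with positive probability [c]. *)
Lemma visit_lower (R : realType) (X : finType) (L Q : set (word X))
    (v u : word X) :
  L `<=` free_group X -> prefix_closed L -> L (v ++ u) ->
  exists2 c : R, 0 < c &
    forall k, c * visit R L Q k (v ++ u) <= visit R L Q (size u + k) v.
Proof.
move=> LF Lc; elim: u v => [|y u IH] v.
  by exists 1 => // j; rewrite mul1r cats0.
rewrite -cat_rcons => Lvyu; have [c c0 cP] := IH _ Lvyu.
have Lvy : L (rcons v y) by apply: mem_prefix_closed Lvyu.
have n0 : (0 : R) < (nu L v)%:R by rewrite ltr0n (nu_gt0 LF Lvy).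
exists ((nu L v)%:R^-1 * c); first by rewrite mulr_gt0 ?invr_gt0.
move=> j /=; rewrite (bigD1 y) /=; last exact/asboolP.
rewrite -[X in X <= _]addr0 lerD //.
  by rewrite -mulrA ler_wpM2l // invr_ge0 ltW.
by apply: sumr_ge0 => z _; rewrite mulr_ge0 ?visit_ge0 // invr_ge0 ltW.
Qed.

Lemma visit_cone (R : realType) (X : finType) (L : set (word X)) (k : nat)
    (w u : word X) :
  L `<=` free_group X -> L (w ++ u) ->
  (forall v, L (w ++ v) -> (0 < nu L (w ++ v))%N) ->
  visit R L (Lcone L w) k (w ++ u) = 1.
Proof.
move=> LF + live; elim: k u => [|k IH] u Lwu /=.
  suff -> : `[< Lcone L w (w ++ u) >] by [].
  by apply/asboolP; split=> //; split; [exact: LF | exact: prefix_prefix].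
under eq_bigr => y /asboolP Ly.
  rewrite rcons_cat IH; last by rewrite -rcons_cat.
  over.
by rewrite step_weight_sum // live.
Qed.

(** With no dead end, all the mass that reaches [w] stays in the cone of [w]:
    the frequencies of the cone are at least the probability [c > 0] of reaching
    [w], which exceeds [q ^+ k] for large [k] if [q < 1]. *)
Lemma live_cone_nonsmall (R : realType) (X : finType) (L : set (word X))
    (w : word X) :
  L `<=` free_group X -> prefix_closed L -> L w ->
  (forall v, L (w ++ v) -> (0 < nu L (w ++ v))%N) ->
  ~ small_Lcone R L w.
Proof.
move=> LF Lc Lw live [q q01 [N small]].
have [c c0 cP] := visit_lower R (Lcone L w) (v := [::]) LF Lc Lw.
have [M qM] := expr_lt_eventually q01 c0.
pose k := (size w + (M + N))%N.
have := small k; rewrite /k addnA leq_addl -addnA => /(_ isT).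
rewrite freq_visit //; last by move=> v [].
move/(le_trans (cP _)); rewrite -[w in visit _ _ _ _ ([::] ++ w)]cats0 /=.
rewrite visit_cone ?cats0 //.
by rewrite mulr1 leNgt qM // addnCA leq_addr.
Qed.

(** * Uniform bounds from finitely many states *)

Lemma accepts_residual (A : finType) (M : dfa A) (v w u : seq A) :
  dfa_run M v = dfa_run M w ->
  dfa_accepts M (v ++ u) = dfa_accepts M (w ++ u).
Proof.
by rewrite /dfa_accepts /dfa_run !foldl_cat => ->.
Qed.

(** For each of the finitely many [s], fix one admissible [t]: the largest
    [h t] is a uniform bound. *)
Lemma bounded_choice (S : finType) (T : Type) (E : S -> T -> Prop)
    (h : T -> nat) :
  exists m, forall s, (exists t, E s t) -> exists2 t, E s t & (h t < m)%N.
Proof.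
have /choice[f fP] : forall s, exists n,
    (exists t, E s t) -> exists2 t, E s t & (h t <= n)%N.
  move=> s; have [[t Est]|no] := pselect (exists t, E s t).
    by exists (h t) => _; exists t.
  by exists 0%N.
exists (\max_s f s).+1 => s /fP[t Est ht]; exists t => //.
by rewrite ltnS (leq_trans ht) // leq_bigmax.
Qed.

(** A bound on the length of the shortest escapes exists because the set of
    escapes of [w] is determined by the states that [w] reaches in automata for
    [L] and for [K]. *)
Lemma escape_bounded (X : finType) (L K : set (word X)) :
  L `<=` free_group X -> regular_set L -> regular_set K ->
  exists m, forall w, (exists u, escapes L (prefix_closure K) w u) ->
    exists2 u, escapes L (prefix_closure K) w u & (size u < m)%N.
Proof.
move=> LF [ML LE] [MK KE].
pose st w := (dfa_run ML w, dfa_run MK w).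
have esc_st v w u : st v = st w ->
    escapes L (prefix_closure K) v u -> escapes L (prefix_closure K) w u.
  move=> [Leq Keq].
  have LL t : L (v ++ t) = L (w ++ t) by rewrite LE /= (accepts_residual _ Leq).
  have KK t : K (v ++ t) = K (w ++ t) by rewrite KE /= (accepts_residual _ Keq).
  have PP : prefix_closure K (v ++ u) <-> prefix_closure K (w ++ u).
    split=> /prefix_closureP[t]; rewrite -catA => Kt; apply/prefix_closureP;
      by exists t; rewrite -catA -?KK // KK.
  (* since L consists of reduced words, nu depends on the residual of L only *)
  have NN : nu L (v ++ u) = nu L (w ++ u).
    apply: eq_card => y; rewrite !inE !rcons_cat LL.
    case: asboolP => [Ly|_]; last by rewrite !andbF.
    have Lv : L (v ++ rcons u y) by rewrite LL.
    by rewrite !andbT; apply/idP/idP => _; exact: LF.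
  by rewrite /escapes LL NN => -[? [NP|?]]; split=> //; [left=> /PP | right].
have [m mP] := bounded_choice
  (fun s u => exists2 w, st w = s & escapes L (prefix_closure K) w u) size.
exists m => w [u esc].
have [|t [v stv esct] tm] := mP (st w); first by exists u, w.
by exists t => //; apply: esc_st esct.
Qed.

(** * The dichotomy *)

Theorem theorem5p4 (R : realType) (X : finType) (L K : set (word X))
    (LF : L `<=` free_group X) (Lclosed : prefix_closed L)
    (Lreg : regular_set L) (KL : K `<=` L) (Kreg : regular_set K) :
  (exists w : word X,
     [/\ free_group X w, Lcone L w `<=` prefix_closure K
       & ~ small_Lcone R L w])
  \/ exp_measurable R L (prefix_closure K).
Proof.
set P := prefix_closure K.
have PL : P `<=` L.
  by move=> w /prefix_closureP[u /KL]; apply: mem_prefix_closed.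
have Pc : prefix_closed P := prefix_closure_idem K.
have [[w [Pw noesc]]|esc] :=
    pselect (exists w, P w /\ ~ exists u, escapes L P w u).
  left; exists w; split; first exact/LF/PL.
    move=> v [Lv [_ /prefixP[u vE]]]; rewrite vE in Lv *.
    by apply: contrapT => NP; apply: noesc; exists u; split=> //; left.
  apply: live_cone_nonsmall => // [|u Lwu]; first exact: PL.
  by rewrite lt0n; apply/eqP => n0; apply: noesc; exists u; split=> //; right.
right; have [m mP] := escape_bounded LF Lreg Kreg.
set d : R := (#|{: letter X}|.+1)%:R^-1.
have d0 : 0 < d by rewrite invr_gt0 ltr0n.
have d1 : d <= 1 by rewrite invf_le1 ?ltr0n // (ler_nat R 1).
have step v : P v -> visit R L P m.+1 v <= 1 - d ^+ m.
  move=> Pv; have [|u escu um] := mP v.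
    by apply: contrapT => no; apply: esc; exists v.
  apply: le_trans (visit_escape R LF Lclosed Pc escu (leqW um)) _.
  by rewrite lerD2l lerN2 ler_wiXn2l ?(ltnW um) ?(ltW d0).
have dm1 : d ^+ m <= 1 by rewrite exprn_ile1 // ltW.
apply: (@geometric_exp_bound _ _ (d ^+ m) m.+1) => //.
  by rewrite exprn_gt0.
by move=> k; rewrite freq_visit // visit_decay // subr_ge0.
Qed.
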